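(* For all integers $n,k,r\ge0$, $$L^{r}(n,k)=\frac{n!}{k!}\binom{n+r-1}{k+r-1}.$$
   Context: Falling factorials: $(x)_0=1$, $(x)_n=x(x-1)\cdots(x-n+1)$ for $n\ge1$. Rising factorials: $\langle x\rangle_0=1$, $\langle x\rangle_n=x(x+1)\cdots(x+n-1)$ for $n\ge 1$. For an integer $r\ge0$, the $r$-Lah numbers $L^r(n,k)$ ($0\le k\le n$) are defined by the polynomial identity $\langle x+r\rangle_n=\sum_{k=0}^n L^r(n,k)(x)_k$ for $n\ge0$; $L^r(n,k)=0$ for $k>n$. Convention for the binomial coefficient in degenerate cases: $\binom{n+r-1}{k+r-1}$ is read as $\binom{n+r-1}{n-k}=\frac{(n+r-1)_{n-k}}{(n-k)!}$ when $n\ge k$, and as $0$ when $k>n$ (so $\binom{-1}{-1}=1$ and $\binom{a}{-1}=0$ for integers $a\ge0$). *)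

(* Defs.v *)
From HB Require Import structures.
From mathcomp Require Import all_boot all_order all_algebra.

Set Implicit Arguments.
Unset Strict Implicit.
Unset Printing Implicit Defensive.

Import Order.TTheory GRing.Theory Num.Theory.
Local Open Scope ring_scope.

(* Used both at x := 'X in {poly rat} and at numerical arguments. *)
Definition falling (A : comNzRingType) (x : A) (n : nat) : A :=
  \prod_(i < n) (x - i%:R).

Definition rising (A : comNzRingType) (x : A) (n : nat) : A :=
  \prod_(i < n) (x + i%:R).

Lemma size_falling (k : nat) : size (falling ('X : {poly rat}) k) = k.+1.
Proof.
rewrite /falling; under eq_bigr => i _ do rewrite -polyC_natr.
by rewrite size_prod_XsubC [index_enum _]unlock -enumT size_enum_ord.
Qed.

Lemma monic_falling (k : nat) : falling ('X : {poly rat}) k \is monic.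
Proof.
by apply: monic_prod => i _; rewrite -polyC_natr monicXsubC.
Qed.

Lemma size_rising (r n : nat) :
  size (rising ('X + r%:R : {poly rat}) n) = n.+1.
Proof.
rewrite /rising; under eq_bigr => i _ do
  rewrite -addrA -natrD -polyC_natr -[X in 'X + X]opprK -polyCN.
by rewrite size_prod_XsubC [index_enum _]unlock -enumT size_enum_ord.
Qed.

Lemma falling_span (n : nat) (p : {poly rat}) : (size p <= n)%N ->
  exists c : {ffun 'I_n -> rat}, p == \sum_(k < n) c k *: falling 'X k.
Proof.
elim: n p => [|n IHn] p.
  rewrite leqn0 size_poly_eq0 => /eqP->; exists [ffun=> 0].
  by rewrite big_ord0.
move=> sp; have [|c /eqP Hc] := IHn (p - p`_n *: falling 'X n).
  apply/leq_sizeP => j; rewrite leq_eqVlt coefB coefZ => /orP[/eqP<-|ltnj].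
    have := monic_falling n; rewrite monicE lead_coefE size_falling => /eqP->.
    by rewrite mulr1 subrr.
  rewrite [p`_j]nth_default ?(leq_trans sp) // [X in _ * X]nth_default.
    by rewrite mulr0 subrr.
  by rewrite size_falling.
exists [ffun k => if unlift ord_max k is Some j then c j else p`_n].
rewrite big_ord_recr /= ffunE unlift_none -subr_eq Hc; apply/eqP.
apply: eq_bigr => i _; rewrite ffunE.
have -> : widen_ord (leqnSn n) i = lift ord_max i.
  by apply: val_inj; rewrite /= /bump leqNgt ltn_ord.
by rewrite liftK.
Qed.

Lemma rLah_exists (r n : nat) : exists c : {ffun 'I_n.+1 -> rat},
  rising ('X + r%:R) n == \sum_(k < n.+1) c k *: falling 'X k.
Proof. by apply: falling_span; rewrite size_rising. Qed.

(* L^r(n,k) is the coefficient of (x)_k in <x+r>_n; rLah_expansion and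
   rLah_unique show that the defining identity determines it. *)
Definition rLah (r n k : nat) : rat :=
  if (k <= n)%N then xchoose (rLah_exists r n) (inord k) else 0.

Lemma rLah_expansion (r n : nat) :
  rising ('X + r%:R) n = \sum_(k < n.+1) rLah r n k *: falling 'X k.
Proof.
rewrite [LHS](eqP (xchooseP (rLah_exists r n))).
by apply: eq_bigr => k _; rewrite /rLah -ltnS ltn_ord inord_val.
Qed.

Lemma falling_free (n : nat) (c : nat -> rat) :
  \sum_(k < n) c k *: falling 'X k = 0 -> forall k, (k < n)%N -> c k = 0.
Proof.
elim: n => [//|n IHn]; rewrite big_ord_recr /= => H.
have cn0 : c n = 0.
  move/(congr1 (fun p : {poly rat} => p`_n)): H.
  rewrite coefD coefZ coef0 coef_sum big1 ?add0r => [|i _]; last first.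
    by rewrite coefZ nth_default ?mulr0 // size_falling.
  have := monic_falling n; rewrite monicE lead_coefE size_falling => /eqP->.
  by rewrite mulr1.
move=> k; rewrite ltnS leq_eqVlt => /orP[/eqP->//|]; apply: IHn.
by rewrite cn0 scale0r addr0 in H.
Qed.

Lemma rLah_unique (r n : nat) (c : nat -> rat) :
  rising ('X + r%:R) n = \sum_(k < n.+1) c k *: falling 'X k ->
  forall k, (k <= n)%N -> c k = rLah r n k.
Proof.
rewrite rLah_expansion => H k lekn; apply/eqP; rewrite -subr_eq0; apply/eqP.
apply: (@falling_free n.+1 (fun j => c j - rLah r n j)) => //.
by under eq_bigr => i _ do rewrite scalerBl; rewrite sumrB -H subrr.
Qed.

(* Binomial coefficient (a choose b) of integers, read as (a choose a - b)
   when b <= a, and as 0 when a < b. In particular (-1 choose -1) = 1 and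
   (a choose -1) = 0 for a >= 0. *)
Definition binomZ (a b : int) : rat :=
  if b <= a then falling (a%:~R : rat) `|a - b|%N / (`|a - b|%N)`!%:R else 0.

(* Main.v *)
Require Import Defs.
From HB Require Import structures.
From mathcomp Require Import all_boot all_order all_algebra.
From mathcomp Require Import ring.

Import Order.TTheory GRing.Theory Num.Theory.
Local Open Scope ring_scope.

(** Reversing the factors, <x + r>_n = (x + (r + n - 1))_n, and the Vandermonde
    identity for falling factorials expands the right-hand side as
    sum_k C(n, k) (r + n - 1)_(n - k) (x)_k. Uniqueness of the coefficients in
    the basis of falling factorials gives the formula. *)

Lemma fallingS (A : comNzRingType) (x : A) (n : nat) :
  falling x n.+1 = falling x n * (x - n%:R).
Proof. by rewrite /falling big_ord_recr. Qed.

(** Applied to [polyC], to recognise a falling factorial of a constant polynomial as a scalar. *)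
Lemma rmorph_falling (A B : comNzRingType) (f : {rmorphism A -> B}) (x : A)
    (n : nat) : f (falling x n) = falling (f x) n.
Proof.
by rewrite /falling rmorph_prod; apply: eq_bigr => i _; rewrite rmorphB rmorph_nat.
Qed.

Lemma rising_falling (A : comNzRingType) (x : A) (n : nat) :
  rising x n = falling (x + n%:R - 1) n.
Proof.
rewrite /rising (reindex_inj rev_ord_inj) /=; apply: eq_bigr => i _.
by rewrite natrB // -[i.+1]addn1 natrD; ring.
Qed.

(** Induction on [n], regrouping terms by Pascal's rule. *)
Lemma falling_Vandermonde (A : comNzRingType) (x y : A) (n : nat) :
  falling (x + y) n =
  \sum_(k < n.+1) 'C(n, k)%:R * (falling x k * falling y (n - k)).
Proof.
elim: n => [|n IHn].
  by rewrite big_ord_recl big_ord0 /falling !big_ord0 !mulr1 addr0.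
(* In the [k]-th term, the new factor [x + y - n] splits as [(y - (n - k)) + (x - k)], each part
   extending one falling factorial. *)
have -> : falling (x + y) n.+1 =
    \sum_(k < n.+1) 'C(n, k)%:R * (falling x k * falling y (n.+1 - k)) +
    \sum_(k < n.+1) 'C(n, k)%:R * (falling x k.+1 * falling y (n - k)).
  rewrite fallingS IHn mulr_suml -big_split /=; apply: eq_bigr => k _.
  have lekn : (k <= n)%N by rewrite -ltnS.
  by rewrite subSn // !fallingS natrB //; ring.
rewrite [RHS]big_ord_recl /= bin0.
under [X in _ = _ + X]eq_bigr => k _ do
  rewrite /bump /= add1n subSS binS natrD mulrDl.
rewrite big_split /= addrA; congr (_ + _).
(* The split-off term [k = 0] rejoins the sum, whose last term vanishes since ['C(n, n.+1) = 0]. *)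
rewrite [RHS](_ : _ = \sum_(k < n.+2) 'C(n, k)%:R *
  (falling x k * falling y (n.+1 - k))); last by rewrite [RHS]big_ord_recl /= bin0.
by rewrite [RHS]big_ord_recr /= bin_small // mul0r addr0.
Qed.

Lemma rLahE (r n k : nat) : (k <= n)%N ->
  rLah r n k = 'C(n, k)%:R * falling (r%:R + n%:R - 1) (n - k).
Proof.
move=> lekn; symmetry; move: k lekn; apply: rLah_unique.
(* Vandermonde is used with ['X] and the constant [r + n - 1]. *)
rewrite rising_falling -!addrA falling_Vandermonde; apply: eq_bigr => k _.
rewrite -mul_polyC rmorphM rmorph_falling /= !polyCD polyCN.
by rewrite polyC1 !polyC_natr -mulrA [falling 'X k * _]mulrC.
Qed.

Theorem mainTheorem8 (n k r : nat) :
  rLah r n k =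
  n`!%:R / k`!%:R * binomZ (n%:Z + r%:Z - 1) (k%:Z + r%:Z - 1).
Proof.
(* The common shift [r - 1] cancels, so the test in [binomZ] is [k <= n], even when [r = 0]. *)
rewrite /binomZ lerD2r lerD2r lez_nat.
case: (leqP k n) => [lekn|ltnk]; last by rewrite /rLah leqNgt ltnk mulr0.
have -> : n%:Z + r%:Z - 1 - (k%:Z + r%:Z - 1) = (n - k)%N.
  by rewrite -subzn //; ring.
have fact_neq0 m : m`!%:R != 0 :> rat by rewrite pnatr_eq0 -lt0n fact_gt0.
(* Writing [n!] as ['C(n, k) * (k! * (n - k)!)] cancels both denominators. *)
rewrite rLahE // absz_nat -(bin_fact lekn) !natrM rmorphB rmorphD /= [n%:~R + _]addrC.
by field; rewrite !fact_neq0.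
Qed.
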